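(* Let $E$ be any graph and let $e\in E^0$. Then the subsemigroup $D_e^0=D_e\cup\{0\}$ of the graph inverse semigroup $G(E)$ is isomorphic to the Brandt $Q_e^0$-extension $\mathcal{B}^0_{Q_e}(\mathcal{P}_{\lambda})$ of the polycyclic monoid $\mathcal{P}_{\lambda}$, where $\lambda=|C_e^1\setminus\{e\}|$.
   Context: Graphs and paths. A graph means a directed graph $E=(E^0,E^1,r,s)$: disjoint sets $E^0$ (vertices) and $E^1$ (edges) with functions $s,r:E^1\to E^0$ (source and range); no finiteness is assumed. A path of non-zero length is a finite sequence of edges $x=e_1\ldots e_n$ ($n\ge 1$) with $r(e_i)=s(e_{i+1})$ for $i<n$; put $s(x)=s(e_1)$, $r(x)=r(e_n)$, $|x|=n$. Each vertex $e$ is a path of length $0$ with $s(e)=r(e)=e$. $\operatorname{Path}(E)$ is the set of all paths. If $r(a)=s(b)$, then $ab$ is the concatenation (vertices act as identities). A path $x$ is a prefix of $y$ if $y=xz$ for some path $z$. Graph inverse semigroup. $G(E)$ is the semigroup with zero $0$ generated by $E^0$, $E^1$ and $E^{-1}=\{e^{-1}\mid e\in E^1\}$ (disjoint from $E^0\cup E^1$) subject to, for $a,b\in E^0$, $e,f\in E^1$: (1) $a\cdot b=a$ if $a=b$ and $a\cdot b=0$ if $a\ne b$; (2) $s(e)\cdot e=e\cdot r(e)=e$; (3) $e^{-1}\cdot s(e)=r(e)\cdot e^{-1}=e^{-1}$; (4) $e^{-1}\cdot f=r(e)$ if $e=f$ and $e^{-1}\cdot f=0$ if $e\neq f$. Each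 non-zero element is uniquely of the form $uv^{-1}$ with $u,v\in\operatorname{Path}(E)$, $r(u)=r(v)$, and $u_1v_1^{-1}\cdot u_2v_2^{-1}$ equals $u_1wv_2^{-1}$ if $u_2=v_1w$ for a path $w$, equals $u_1(v_2w)^{-1}$ if $v_1=u_2w$ for a path $w$, and equals $0$ otherwise. $\mathcal{D}$-classes. $\mathcal{D}=\mathcal{L}\circ\mathcal{R}$ is Green's relation. Each non-zero $\mathcal{D}$-class of $G(E)$ contains exactly one vertex; $D_e$ denotes the $\mathcal{D}$-class containing the vertex $e$, i.e. $D_e=\{uv^{-1}\mid u,v\in\operatorname{Path}(E),\ r(u)=r(v)=e\}$. Sets attached to a vertex $e$. $I_e=\{u\in\operatorname{Path}(E)\mid r(u)=e\}$. $Q_e$ is the set of $u\in I_e$ such that $r(v)\neq e$ for every prefix $v$ of $u$ with $v\neq u$ (the length-zero prefix $v=s(u)$ is included when $|u|>0$). $C_e=\{u\in\operatorname{Path}(E)\mid s(u)=r(u)=e\}$. $C_e^1$ is the set of $u\in C_e$ such that $r(v)\ne e$ for every prefix $v$ of $u$ with $v\neq u$ and $|v|>0$. In particular $e\in Q_e$ and $e\in C_e^1$. Polycyclic monoid. For a cardinal $\lambda$, $\mathcal{P}_\lambda$ is the semigroup with identity $1$ and zero $0$ given by the presentation $\langle 0,1,\{p_i\}_{i\in\lambda},\{p_i^{-1}\}_{i\in\lambda}\mid p_i^{-1}p_i=1,\ p_j^{-1}p_i=0\text{ for } i\ne j\rangle$; $\mathcal{P}_0$ is the semilattice $(\{0,1\},\min)$.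 Brandt extension. For a semigroup $S$ with zero $0_S$ and a non-empty set $X$, $\mathcal{B}_X(S)=X\times S\times X\sqcup\{0\}$ with $(a,s,b)\cdot(c,t,d)=(a,st,d)$ if $b=c$ and $0$ if $b\ne c$, and all products involving $0$ equal to $0$. The Brandt $X^0$-extension $\mathcal{B}_X^0(S)$ is the Rees factor semigroup of $\mathcal{B}_X(S)$ by the ideal $\{(a,0_S,b)\mid a,b\in X\}\cup\{0\}$. *)

(* Defs.v *)
From HB Require Import structures.
From mathcomp Require Import all_boot.
From mathcomp Require Import boolp classical_sets functions cardinality.

Set Implicit Arguments.
Unset Strict Implicit.
Unset Printing Implicit Defensive.

Local Open Scope classical_set_scope.
Local Open Scope quotient_scope.
Local Open Scope group_scope.

HB.mixin Record Semigroup_hasZero S of Semigroup S := {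
  szero : S;
  mul0s : forall x : S, szero * x = szero;
  muls0 : forall x : S, x * szero = szero
}.

#[short(type="semigroup0Type")]
HB.structure Definition Semigroup0 := {S of Semigroup_hasZero S & Semigroup S}.

Arguments szero {s}.

Section Semigroups.

Record congruence (S : semigroupType) := Congruence {
  crel :> S -> S -> Prop;
  crel_refl : forall x, crel x x;
  crel_sym : forall x y, crel x y -> crel y x;
  crel_trans : forall x y z, crel x y -> crel y z -> crel x z;
  crel_mul : forall x x' y y', crel x x' -> crel y y' -> crel (x * y) (x' * y')
}.

Section Quotient.
Context (S : semigroupType) (c : congruence S).

Definition crelb : rel S := fun x y => `[< c x y >].

Lemma crelb_refl : reflexive crelb.
Proof. by move=> x; apply/asboolP/crel_refl. Qed.

Lemma crelb_sym : symmetric crelb.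
Proof. by move=> x y; apply/asboolP/asboolP => /crel_sym. Qed.

Lemma crelb_trans : transitive crelb.
Proof.
by move=> y x z /asboolP xy /asboolP yz; apply/asboolP/(crel_trans xy yz).
Qed.

Definition crel_equiv := EquivRel crelb crelb_refl crelb_sym crelb_trans.

Definition quot := {eq_quot crel_equiv}.

HB.instance Definition _ := Choice.on quot.

Definition quot_pi (x : S) : quot := \pi_{eq_quot crel_equiv} x.

Definition quot_repr (x : quot) : S := repr x.

Lemma quot_reprK : cancel quot_repr quot_pi.
Proof. exact: reprK. Qed.

Lemma quot_piP (x y : S) : quot_pi x = quot_pi y <-> c x y.
Proof.
by split=> [/eqmodP /asboolP //|cxy]; apply/eqmodP/asboolP.
Qed.

Definition quot_mul (x y : quot) : quot := quot_pi (quot_repr x * quot_repr y).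

Lemma quot_mulE (x y : S) : quot_mul (quot_pi x) (quot_pi y) = quot_pi (x * y).
Proof. by apply/quot_piP/crel_mul; apply/quot_piP; rewrite quot_reprK. Qed.

Lemma quot_mulA : associative quot_mul.
Proof.
move=> x y z; rewrite -(quot_reprK x) -(quot_reprK y) -(quot_reprK z).
by rewrite !quot_mulE mulgA.
Qed.

HB.instance Definition _ := isSemigroup.Build quot quot_mulA.

End Quotient.

Section QuotientZero.
Context (S : semigroup0Type) (c : congruence S).

Lemma quot_mul0s (x : quot c) : quot_pi c szero * x = quot_pi c szero.
Proof. by rewrite -(quot_reprK x) [LHS]quot_mulE mul0s. Qed.

Lemma quot_muls0 (x : quot c) : x * quot_pi c szero = quot_pi c szero.
Proof. by rewrite -(quot_reprK x) [LHS]quot_mulE muls0. Qed.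

HB.instance Definition _ :=
  Semigroup_hasZero.Build (quot c) quot_mul0s quot_muls0.

End QuotientZero.

Inductive gen_crel (S : semigroupType) (R : S -> S -> Prop) : S -> S -> Prop :=
| gen_rel x y : R x y -> gen_crel R x y
| gen_refl x : gen_crel R x x
| gen_sym x y : gen_crel R x y -> gen_crel R y x
| gen_trans x y z : gen_crel R x y -> gen_crel R y z -> gen_crel R x z
| gen_mul x x' y y' :
    gen_crel R x x' -> gen_crel R y y' -> gen_crel R (x * y) (x' * y').

Definition gen_cong (S : semigroupType) (R : S -> S -> Prop) : congruence S :=
  Congruence (@gen_refl S R) (@gen_sym S R) (@gen_trans S R) (@gen_mul S R).

Record ideal (S : semigroupType) := Ideal {
  iset : set S;
  idealMl : forall x y, iset y -> iset (x * y);
  idealMr : forall x y, iset x -> iset (x * y)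
}.

Section Rees.
Context (S : semigroupType) (I : ideal S).

Definition rees_rel (x y : S) : Prop := x = y \/ iset I x /\ iset I y.

Lemma rees_refl x : rees_rel x x.
Proof. by left. Qed.

Lemma rees_sym x y : rees_rel x y -> rees_rel y x.
Proof. by case=> [->|[Ix Iy]]; [left|right]. Qed.

Lemma rees_trans x y z : rees_rel x y -> rees_rel y z -> rees_rel x z.
Proof. by case=> [->//|[Ix Iy]] [<-|[_ Iz]]; right. Qed.

Lemma rees_mul x x' y y' :
  rees_rel x x' -> rees_rel y y' -> rees_rel (x * y) (x' * y').
Proof.
case=> [->|[Ix Ix']]; last by move=> _; right; split; apply: idealMr.
by case=> [->|[Iy Iy']]; [left|right; split; apply: idealMl].
Qed.

Definition rees_cong : congruence S :=
  Congruence rees_refl rees_sym rees_trans rees_mul.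

End Rees.

(* [S^1 a], the principal left ideal of [a], and dually on the right. *)
Definition lideal (S : semigroupType) (a : S) : set S :=
  [set x | x = a \/ exists y, x = y * a].
Definition rideal (S : semigroupType) (a : S) : set S :=
  [set x | x = a \/ exists y, x = a * y].

Definition green_L (S : semigroupType) (a b : S) : Prop := lideal a = lideal b.
Definition green_R (S : semigroupType) (a b : S) : Prop := rideal a = rideal b.
Definition green_D (S : semigroupType) (a b : S) : Prop :=
  exists c, green_L a c /\ green_R c b.

Definition subsemigroup (S : semigroupType) (A : set S) : Prop :=
  forall x y, A x -> A y -> A (x * y).

Definition subsemigroup_iso (S : semigroupType) (A : set S) (T : semigroupType)
    : Prop :=
  exists f : S -> T,
    set_bij A [set: T] f /\ (forall x y, A x -> A y -> f (x * y) = f x * f y).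

End Semigroups.

(* The free semigroup with zero on [X]: [None] is the zero, and [Some (x, s)]
   is the nonempty word [x :: s]. *)
Definition free0 (X : Type) : Type := option (X * seq X).

Section Free0.
Context (X : Type).

HB.instance Definition _ := gen_eqMixin (free0 X).
HB.instance Definition _ := gen_choiceMixin (free0 X).

Definition free0_mul (u v : free0 X) : free0 X :=
  match u, v with
  | Some (x, s), Some (y, t) => Some (x, s ++ y :: t)
  | _, _ => None
  end.

Lemma free0_mulA : associative free0_mul.
Proof. by move=> [[x s]|] [[y t]|] [[z u]|] //=; rewrite -catA. Qed.

HB.instance Definition _ := isSemigroup.Build (free0 X) free0_mulA.

Lemma free0_mul0s (u : free0 X) : (None : free0 X) * u = None.
Proof. by []. Qed.

Lemma free0_muls0 (u : free0 X) : u * (None : free0 X) = None.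
Proof. by case: u => [[]|]. Qed.

HB.instance Definition _ :=
  Semigroup_hasZero.Build (free0 X) free0_mul0s free0_muls0.

Definition letter (x : X) : free0 X := Some (x, [::]).

End Free0.

Record graph := Graph {
  vertex : Type;
  edge : Type;
  src : edge -> vertex;
  tgt : edge -> vertex
}.

Arguments src {g}.
Arguments tgt {g}.

Section Paths.
Context {E : graph}.
Implicit Types (a b : vertex E) (s : seq (edge E)).

Fixpoint walk a s : Prop :=
  if s is x :: s' then src x = a /\ walk (tgt x) s' else True.

Definition walk_end a s : vertex E := last a (map tgt s).

(* The source is recorded so that the path of length 0 at [a] can be
   represented, by [a] and the empty sequence; for a nonempty sequence of edges
   it is determined by the first edge. *)
Record path := Path {
  psrc : vertex E;
  pedges : seq (edge E);
  _ : walk psrc pedges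
}.

Definition ptgt (p : path) : vertex E := walk_end (psrc p) (pedges p).
Definition plen (p : path) : nat := size (pedges p).

Definition vpath a : path := @Path a [::] I.

Lemma walk_cat a b s t :
  walk a s -> walk b t -> walk_end a s = b -> walk a (s ++ t).
Proof.
rewrite /walk_end; elim: s a => [|x s IHs] a /=; first by move=> _ + ->.
by move=> [<- ws] wt ab; split=> //; apply: IHs.
Qed.

Lemma pathP (p : path) : walk (psrc p) (pedges p).
Proof. by case: p. Qed.

Definition pcat (p q : path) (pq : ptgt p = psrc q) : path :=
  Path (walk_cat (pathP p) (pathP q) pq).

Definition is_prefix (x y : path) : Prop :=
  exists (z : path) (xz : ptgt x = psrc z), y = pcat xz.

Context (e : vertex E).

Definition I_set : set path := [set u | ptgt u = e].

Definition Q_set : set path :=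
  [set u | I_set u /\ forall v, is_prefix v u -> v <> u -> ptgt v <> e].

Definition C_set : set path := [set u | psrc u = e /\ ptgt u = e].

Definition C1_set : set path :=
  [set u | C_set u /\
    forall v, is_prefix v u -> v <> u -> (0 < plen v)%N -> ptgt v <> e].

End Paths.

Arguments path E : clear implicits.

Section GraphInverseSemigroup.
Context (E : graph).

Inductive gis_letter :=
  | gvertex of vertex E
  | gedge of edge E
  | ginv of edge E.

Notation V a := (letter (gvertex a)).
Notation P x := (letter (gedge x)).
Notation N x := (letter (ginv x)).

Inductive gis_rel : free0 gis_letter -> free0 gis_letter -> Prop :=
| gis_vv a : gis_rel (V a * V a) (V a)
| gis_vw a b : a <> b -> gis_rel (V a * V b) szero
| gis_se x : gis_rel (V (src x) * P x) (P x)
| gis_er x : gis_rel (P x * V (tgt x)) (P x)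
| gis_is x : gis_rel (N x * V (src x)) (N x)
| gis_ri x : gis_rel (V (tgt x) * N x) (N x)
| gis_ie x : gis_rel (N x * P x) (V (tgt x))
| gis_if x y : x <> y -> gis_rel (N x * P y) szero.

Definition gis : semigroup0Type := quot (gen_cong gis_rel).

Definition gis_vertex (a : vertex E) : gis := quot_pi (gen_cong gis_rel) (V a).

Definition D_class (e : vertex E) : set gis :=
  [set x | green_D x (gis_vertex e)].

Definition D0_class (e : vertex E) : set gis := D_class e `|` [set szero].

End GraphInverseSemigroup.

Section Polycyclic.
Context (L : Type).

Inductive pol_letter := pol_one | pol_p of L | pol_inv of L.

Notation P i := (letter (pol_p i)).
Notation N i := (letter (pol_inv i)).

Inductive pol_rel : free0 pol_letter -> free0 pol_letter -> Prop :=
| pol_1l w : pol_rel (letter pol_one * w) w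
| pol_1r w : pol_rel (w * letter pol_one) w
| pol_ii i : pol_rel (N i * P i) (letter pol_one)
| pol_ij i j : i <> j -> pol_rel (N j * P i) szero.

Definition polycyclic : semigroup0Type := quot (gen_cong pol_rel).

End Polycyclic.

Definition brandt (X S : Type) : Type := option (X * S * X).

Section Brandt.
Context (X : Type) (S : semigroupType).

HB.instance Definition _ := gen_eqMixin (brandt X S).
HB.instance Definition _ := gen_choiceMixin (brandt X S).

Definition brandt_mul (u v : brandt X S) : brandt X S :=
  match u, v with
  | Some (a, s, b), Some (c, t, d) =>
      if `[< b = c >] then Some (a, s * t, d) else None
  | _, _ => None
  end.

Lemma brandt_mulA : associative brandt_mul.
Proof.
move=> [[[a s] b]|] [[[c t] d]|] [[[f u] g]|] //=; last by case: ifP.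
case: (asboolP (b = c)) => bc; case: (asboolP (d = f)) => df //=.
- by rewrite asboolT // asboolT // mulgA.
- by rewrite asboolF.
- by rewrite asboolF.
Qed.

HB.instance Definition _ := isSemigroup.Build (brandt X S) brandt_mulA.

End Brandt.

Section Brandt0.
Context (X : Type) (S : semigroup0Type).

Definition brandt_zeros : set (brandt X S) :=
  [set u | u = None \/ exists a b, u = Some (a, szero, b)].

Lemma brandt_zerosMl (u v : brandt X S) :
  brandt_zeros v -> brandt_zeros (u * v).
Proof.
case: u => [[[a s] b]|]; last by left.
case=> [->|[c [d ->]]]; first by left.
rewrite /mul/=; case: ifP => _; last by left.
by right; exists a, d; rewrite muls0.
Qed.

Lemma brandt_zerosMr (u v : brandt X S) :
  brandt_zeros u -> brandt_zeros (u * v).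
Proof.
case=> [->|[a [b ->]]]; first by left.
case: v => [[[c t] d]|]; last by left.
rewrite /mul/=; case: ifP => _; last by left.
by right; exists a, d; rewrite mul0s.
Qed.

Definition brandt0 : semigroupType :=
  quot (rees_cong (Ideal brandt_zerosMl brandt_zerosMr)).

End Brandt0.

(* Main.v *)
Require Import Defs.
From HB Require Import structures.
From mathcomp Require Import all_boot.
From mathcomp Require Import boolp classical_sets functions cardinality.

Set Implicit Arguments.
Unset Strict Implicit.
Unset Printing Implicit Defensive.

Local Open Scope classical_set_scope.
Local Open Scope card_scope.
Local Open Scope group_scope.

(** Write [F u] and [B v] for the images of [u] and [v^-1] in [G(E)], so that
   the elements of [D_e] are the [F u * B v] with [u] and [v] paths ending at
   [e]. The isomorphism is built from the Brandt extension to [G(E)]: it is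

       (q, x, q')  |->  F q * h x * B q'

   where [h] is the homomorphism from the polycyclic monoid to [G(E)] that
   sends [1] to [e] and [p_i] to [F c_i], for an enumeration [c] of
   [C_e^1 \ {e}]. Its inverse on the range is the map asked for.

   Both [Q_e] and [C_e^1 \ {e}] are prefix codes: a proper prefix of one of
   their members, of positive length in the second case, is forbidden to end at
   [e] ([Q_prefix], [C1_prefix]). For [u] and [v] ending at [e], [B u * F v] is
   [e] if [u = v] and [0] if neither path is a prefix of the other ([bwdK],
   [bwd_fwd_prefix0]). Hence the [F c_i] and [B c_i] satisfy the relations of
   the polycyclic monoid, so [h] exists ([pol_letter_val_rel]), and [B q * F q']
   is [e] or [0], so the map is multiplicative ([brandt_gisM]).

   For bijectivity, cutting a path that ends at [e] at each of its visits to
   [e] writes it in exactly one way as [q c_{i_1} ... c_{i_n}] with [q] in [Q_e]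
   ([factorization], [append_inj]). Every non-zero element of the polycyclic
   monoid is of the form [p_s p_t^{-1}] for words [s], [t] ([polycyclic_nf]),
   and [(q, p_s p_t^{-1}, q')] is sent to [F (q c_s) * B (q' c_t)]
   ([brandt_pre_nf]). Thus surjectivity is existence of the factorization, and
   injectivity is its uniqueness together with uniqueness of normal forms in
   [G(E)] ([nf_inj]).

   Uniqueness of normal forms in [G(E)] comes from its action by partial maps:
   [F u * B v] sends [v w] to [u w] for all [w] and is undefined elsewhere, so
   [v] and [u] are read off from its domain and its image. The same action
   identifies the class [D_e] ([D_classP]), because [L]-related elements have
   the same domain and [R]-related elements the same image. *)

(** * Maps out of semigroups given by generators and relations *)

Lemma quot_reprE (S : semigroupType) (c : congruence S) (T : Type)
    (f : S -> T) :
  (forall x y, c x y -> f x = f y) ->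
  forall x, f (quot_repr (quot_pi c x)) = f x.
Proof. by move=> fc x; apply: fc; apply/quot_piP; rewrite quot_reprK. Qed.

Lemma quot_piM (S : semigroupType) (c : congruence S) (x y : S) :
  quot_pi c x * quot_pi c y = quot_pi c (x * y).
Proof. exact: quot_mulE. Qed.

Section Presentation.
Context (X : Type) (R : free0 X -> free0 X -> Prop).
Local Notation Q := (quot (gen_cong R)).
Local Notation gen x := (quot_pi (gen_cong R) (letter x)).

Lemma presented_ind (P : Q -> Prop) :
    P szero -> (forall x, P (gen x)) ->
    (forall x y, P y -> P (gen x * y)) ->
  forall y, P y.
Proof.
move=> P0 P1 PM y; rewrite -(quot_reprK y).
case: (quot_repr y) => [[x s]|//]; elim: s x => [//|z s IHs] x.
by have := PM x _ (IHs z); rewrite quot_piM.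
Qed.

Context (T : semigroup0Type) (f : X -> T).

Fixpoint word_val x s : T := if s is y :: s' then f x * word_val y s' else f x.

Definition free0_val (u : free0 X) : T :=
  if u is Some (x, s) then word_val x s else szero.

Lemma free0_valM u v : free0_val (u * v) = free0_val u * free0_val v.
Proof.
case: u v => [[x s]|] [[y t]|] /=; rewrite ?mul0s ?muls0 //.
by elim: s x => [//|z s IHs] x /=; rewrite IHs mulgA.
Qed.

(** The value of a representative, which is a homomorphism once [f] satisfies
   the relations [R]. *)
Definition presented_val (x : Q) : T := free0_val (quot_repr x).

Context (fR : forall u v, R u v -> free0_val u = free0_val v).

Lemma presented_val_pi u : presented_val (quot_pi (gen_cong R) u) = free0_val u.
Proof.
apply: quot_reprE => x y; elim=> {x y} //.
- by move=> x y z _ -> _.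
- by move=> x x' y y' _ xx' _ yy'; rewrite !free0_valM xx' yy'.
Qed.

Lemma presented_valM x y :
  presented_val (x * y) = presented_val x * presented_val y.
Proof.
rewrite -(quot_reprK x) -(quot_reprK y) quot_piM !presented_val_pi.
exact: free0_valM.
Qed.

End Presentation.

(** Lets the isomorphism be constructed in the convenient direction, out of the
   semigroup that has a presentation. *)
Lemma subsemigroup_iso_range (S T : semigroupType) (g : T -> S) :
    (forall x y, g (x * y) = g x * g y) -> injective g -> T ->
  subsemigroup (range g) /\ subsemigroup_iso (range g) T.
Proof.
move=> gM g_inj x0; split.
  by move=> _ _ [x _ <-] [y _ <-]; exists (x * y); rewrite ?gM.
pose f y := xget x0 [set x | g x = y].
have fK x : f (g x) = x.
  by apply: g_inj; rewrite /f; case: xgetP => [y _ //|/(_ x) []].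
exists f; split; last by move=> _ _ [x _ <-] [y _ <-]; rewrite -gM !fK.
split=> //.
- by move=> _ _ /set_mem[x _ <-] /set_mem[y _ <-]; rewrite !fK => ->.
- by move=> x _; exists (g x); [exists x|rewrite fK].
Qed.

(** * Homomorphisms out of a Brandt extension *)

(** The data [l], [r] behave like a column and a row of matrix units over the
   corner with identity [u]: [r x * l y] is the identity or zero, which is
   exactly what the product of triples requires. *)
Section BrandtHom.
Context (X : Type) (S T : semigroup0Type) (h : S -> T) (l r : X -> T).
Context (u : T).
Context (h0 : h szero = szero) (hM : forall s t, h (s * t) = h s * h t).
Context (hu : forall s, h s * u = h s).
Context (rl : forall x, r x * l x = u).
Context (rl0 : forall x y, x <> y -> r x * l y = szero).

Definition brandt_val (x : brandt X S) : T :=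
  if x is Some (a, s, b) then l a * h s * r b else szero.

Definition brandt0_val (x : brandt0 X S) : T := brandt_val (quot_repr x).

Lemma brandt0_val_pi x : brandt0_val (quot_pi _ x) = brandt_val x.
Proof.
have zero y : brandt_zeros y -> brandt_val y = szero.
  by case=> [->|[a [b ->]]] //=; rewrite h0 muls0 mul0s.
by apply: quot_reprE => y z [->|[/zero-> /zero->]].
Qed.

Lemma brandt_valM x y : brandt_val (x * y) = brandt_val x * brandt_val y.
Proof.
rewrite -[x * y]/(brandt_mul x y).
case: x y => [[[a s] b]|] [[[c t] d]|] /=; rewrite ?mul0s ?muls0 //.
case: asboolP => [<-|bc] /=.
  by rewrite hM !mulgA -(mulgA _ (r b)) rl -(mulgA _ (h s) u) hu.
by rewrite !mulgA -(mulgA _ (r b)) rl0 // muls0 !mul0s.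
Qed.

Lemma brandt0_valM x y : brandt0_val (x * y) = brandt0_val x * brandt0_val y.
Proof.
rewrite -(quot_reprK x) -(quot_reprK y) quot_piM !brandt0_val_pi.
exact: brandt_valM.
Qed.

End BrandtHom.

(** * The semigroup of partial maps *)

Definition pfun (T : Type) : Type := T -> option T.

Section PartialMaps.
Context (T : Type).

HB.instance Definition _ := gen_eqMixin (pfun T).
HB.instance Definition _ := gen_choiceMixin (pfun T).

Definition pfun_mul (f g : pfun T) : pfun T := fun t => obind f (g t).

Lemma pfun_mulA : associative pfun_mul.
Proof. by move=> f g h; apply/funext => t; rewrite /pfun_mul; case: (h t). Qed.

HB.instance Definition _ := isSemigroup.Build (pfun T) pfun_mulA.

Definition pfun0 : pfun T := fun=> None.

Lemma pfun_mul0s (f : pfun T) : pfun0 * f = pfun0.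
Proof. by apply/funext => t; rewrite /mul /= /pfun_mul; case: (f t). Qed.

Lemma pfun_muls0 (f : pfun T) : f * pfun0 = pfun0.
Proof. by []. Qed.

HB.instance Definition _ :=
  Semigroup_hasZero.Build (pfun T) pfun_mul0s pfun_muls0.

End PartialMaps.

Lemma pfun_mulE (T : Type) (f g : pfun T) t : (f * g) t = obind f (g t).
Proof. by []. Qed.

(** * Paths and prefixes *)

Lemma cat_antisym (T : Type) (s t r r' : seq T) :
  s = t ++ r -> t = s ++ r' -> s = t.
Proof.
move=> st ts; suff r0 : r = [::] by rewrite st r0 cats0.
apply/size0nil/eqP; rewrite -leqn0 -(leq_add2l (size t)) addn0 -size_cat -st.
by rewrite ts size_cat leq_addr.
Qed.

Lemma cat_comparable (T : Type) (s t s' t' : seq T) :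
    s ++ s' = t ++ t' ->
  (exists r, t = s ++ r) \/ (exists r, s = t ++ r).
Proof.
elim: s t => [|x s IHs] [|y t] /=; try by [left; eexists|right; eexists].
by case=> <- /IHs[[r ->]|[r ->]]; [left|right]; exists r.
Qed.

Lemma cat_injr (T : Type) (s t r : seq T) : s ++ t = s ++ r -> t = r.
Proof. by elim: s => //= x s IHs [/IHs]. Qed.

Section Paths.
Context (E : graph).
Implicit Types (a b : vertex E) (s t : seq (edge E)) (u v : Defs.path E).

Lemma walk_catE a s t :
  walk a (s ++ t) <-> walk a s /\ walk (walk_end a s) t.
Proof.
elim: s a => [|x s IHs] a; first by split=> [|[]].
by rewrite /= IHs; split=> [[? []]|[[]]].
Qed.

Lemma walk_end_cat a s t : walk_end a (s ++ t) = walk_end (walk_end a s) t.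
Proof. by rewrite /walk_end map_cat last_cat. Qed.

Lemma path_eq u v : psrc u = psrc v -> pedges u = pedges v -> u = v.
Proof.
case: u v => [a s ws] [b t wt] /= ab st; subst b t.
by congr Path; exact: Prop_irrelevance.
Qed.

Lemma is_prefixP u v :
  is_prefix u v <-> psrc u = psrc v /\ exists r, pedges v = pedges u ++ r.
Proof.
split=> [[z [uz ->]]|[uv [r vE]]]; first by split=> //; exists (pedges z).
have := Defs.pathP v; rewrite -uv vE => /walk_catE[_ wr].
by exists (Path wr), erefl; apply: path_eq.
Qed.

(** [Q_set e] is a prefix code: a proper prefix of [v] may not end at [e]. *)
Lemma Q_prefix e u v : Q_set e u -> Q_set e v -> is_prefix u v -> u = v.
Proof. by move=> [Iu _] [_ vQ] uv; apply: contrapT => /(vQ _ uv). Qed.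

(** Without the trivial path the first-return loops form a prefix code, for the
   same reason; a prefix of length [0] must be excluded because only prefixes
   of positive length are prevented from ending at [e]. *)
Lemma C1_prefix e u v :
  (C1_set e `\ vpath e) u -> C1_set e v -> is_prefix u v -> u = v.
Proof.
move=> [[[su tu] _] u1] [_ vC] uv; apply: contrapT => /(vC _ uv); apply=> //.
rewrite lt0n; apply/eqP => /size0nil u0.
by apply: u1; apply: path_eq.
Qed.

End Paths.

(** * Normal forms in the graph inverse semigroup *)

Section GraphInverse.
Context (E : graph).
Implicit Types (a b : vertex E) (x y : edge E) (s t : seq (edge E)).
Implicit Types (u v : Defs.path E).

Local Notation V a := (gis_vertex a : gis E).
Definition gis_edge x : gis E := quot_pi _ (letter (gedge x)).
Definition gis_edgeV x : gis E := quot_pi _ (letter (ginv x)).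
Local Notation P := gis_edge.
Local Notation N := gis_edgeV.

Lemma gis_relE w w' :
  gis_rel w w' -> quot_pi (gen_cong (@gis_rel E)) w = quot_pi _ w'.
Proof. by move=> ww'; apply/quot_piP/gen_rel. Qed.

Lemma vertexK a : V a * V a = V a.
Proof. by rewrite quot_piM; apply/gis_relE/gis_vv. Qed.

Lemma vertex_neq a b : a <> b -> V a * V b = szero.
Proof. by move=> ab; rewrite quot_piM; apply/gis_relE/gis_vw. Qed.

Lemma src_edge x : V (src x) * P x = P x.
Proof. by rewrite quot_piM; apply/gis_relE/gis_se. Qed.

Lemma edge_tgt x : P x * V (tgt x) = P x.
Proof. by rewrite quot_piM; apply/gis_relE/gis_er. Qed.

Lemma edgeV_src x : N x * V (src x) = N x.
Proof. by rewrite quot_piM; apply/gis_relE/gis_is. Qed.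

Lemma tgt_edgeV x : V (tgt x) * N x = N x.
Proof. by rewrite quot_piM; apply/gis_relE/gis_ri. Qed.

Lemma edgeVK x : N x * P x = V (tgt x).
Proof. by rewrite quot_piM; apply/gis_relE/gis_ie. Qed.

Lemma edgeV_neq x y : x <> y -> N x * P y = szero.
Proof. by move=> xy; rewrite quot_piM; apply/gis_relE/gis_if. Qed.

(** For a walk [s] from [a], [fwd a s] is the image of the path in [G(E)] and
   [bwd a s] is its inverse; the end vertex is kept as a last factor so that
   the empty walk needs no separate treatment. *)
Fixpoint fwd a s : gis E := if s is x :: s' then P x * fwd (tgt x) s' else V a.
Fixpoint bwd a s : gis E := if s is x :: s' then bwd (tgt x) s' * N x else V a.

Lemma src_fwd a s : walk a s -> V a * fwd a s = fwd a s.
Proof.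
by case: s => [|x s] /= => [_|[<- _]]; rewrite ?vertexK // mulgA src_edge.
Qed.

Lemma bwd_src a s : walk a s -> bwd a s * V a = bwd a s.
Proof.
by case: s => [|x s] /= => [_|[<- _]]; rewrite ?vertexK // -mulgA edgeV_src.
Qed.

Lemma fwd_tgt a s : fwd a s * V (walk_end a s) = fwd a s.
Proof. by elim: s a => [|x s IHs] a /=; rewrite ?vertexK // -mulgA IHs. Qed.

Lemma tgt_bwd a s : V (walk_end a s) * bwd a s = bwd a s.
Proof. by elim: s a => [|x s IHs] a /=; rewrite ?vertexK // mulgA IHs. Qed.

Lemma fwd_cat a s t : walk (walk_end a s) t ->
  fwd a s * fwd (walk_end a s) t = fwd a (s ++ t).
Proof.
elim: s a => [|x s IHs] a /= wt; first by rewrite src_fwd.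
by rewrite -mulgA IHs.
Qed.

Lemma bwd_cat a s t : walk (walk_end a s) t ->
  bwd (walk_end a s) t * bwd a s = bwd a (s ++ t).
Proof.
elim: s a => [|x s IHs] a /= wt; first by rewrite bwd_src.
by rewrite mulgA IHs.
Qed.

Lemma bwdK a s : walk a s -> bwd a s * fwd a s = V (walk_end a s).
Proof.
elim: s a => [|x s IHs] a /=; first by rewrite vertexK.
case=> _ ws; rewrite -mulgA (mulgA (N x)) edgeVK src_fwd //.
exact: IHs.
Qed.

(** Cancelling common edges stops either at two different edges, or at the end
   of one of the paths with the vertices there different; both give [0]. *)
Lemma bwd_fwd0 a s b t : walk a s -> walk b t ->
  ~ (a = b /\ ((exists r, t = s ++ r) \/ (exists r, s = t ++ r))) ->
  bwd a s * fwd b t = szero.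
Proof.
elim: s a b t => [|x s IHs] a b t /=.
  move=> _ wt abt; rewrite -(src_fwd wt) mulgA vertex_neq ?mul0s // => ab.
  by apply: abt; split=> //; left; exists t.
case=> ax ws; case: t => [_|y t /= [yb wt]] st /=.
  rewrite -mulgA -edgeV_src -mulgA vertex_neq ?muls0 // ax => ab.
  by apply: st; split=> //; right; exists (x :: s).
rewrite -mulgA (mulgA (N x)); have [xy|xy] := pselect (x = y); last first.
  by rewrite edgeV_neq // mul0s muls0.
subst y; rewrite edgeVK src_fwd // IHs // => -[_ st'].
apply: st; split; first by rewrite -ax.
by case: st' => -[r ->]; [left|right]; exists r.
Qed.

(** The action lives on all pairs of a vertex and a sequence of edges, rather
   than on paths: the defining relations already hold there, and no proof that
   a result is again a walk has to be carried along. *)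
Definition point : Type := vertex E * seq (edge E).

Definition gis_step (l : gis_letter E) : pfun point :=
  match l with
  | gvertex a => fun p => if `[< p.1 = a >] then Some p else None
  | gedge x =>
      fun p => if `[< p.1 = tgt x >] then Some (src x, x :: p.2) else None
  | ginv x => fun p =>
      if p is (a, y :: s) then
        if `[< a = src x /\ y = x >] then Some (tgt x, s) else None
      else None
  end.

Lemma gis_step_rel w w' :
  gis_rel w w' -> free0_val gis_step w = free0_val gis_step w'.
Proof.
case=> {w w'} [a|a b ab|x|x|x|x|x|x y xy]; apply/funext => -[c s] /=;
  rewrite pfun_mulE /=.
- by case: asboolP => //= ca; rewrite asboolT.
- by case: asboolP => //= cb; rewrite asboolF // => ca; apply: ab; rewrite -ca.
- by case: asboolP => //= ca; rewrite asboolT.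
- by case: asboolP => //= ca; rewrite asboolT.
- case: s => [|y s]; first by case: asboolP.
  by case: asboolP => //= ca; rewrite asboolF // => -[].
- case: s => [|y s] //.
  by case: asboolP => //= ca; rewrite asboolT.
- by case: asboolP => //= ->; rewrite asboolT.
- by case: asboolP => //= _; rewrite asboolF // => -[_ /esym].
Qed.

Definition gact : gis E -> pfun point := presented_val gis_step.

Lemma gactM g h p : gact (g * h) p = obind (gact g) (gact h p).
Proof. by rewrite /gact (presented_valM gis_step_rel). Qed.

Lemma gact0 p : gact szero p = None.
Proof. by rewrite /gact (presented_val_pi gis_step_rel). Qed.

Lemma gact_vertex a p :
  gact (V a) p = if `[< p.1 = a >] then Some p else None.
Proof. by rewrite /gact (presented_val_pi gis_step_rel). Qed.

Lemma gact_edge x p :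
  gact (P x) p = if `[< p.1 = tgt x >] then Some (src x, x :: p.2) else None.
Proof. by rewrite /gact (presented_val_pi gis_step_rel). Qed.

Lemma gact_edgeV x p : gact (N x) p = gis_step (ginv x) p.
Proof. by rewrite /gact (presented_val_pi gis_step_rel). Qed.

Lemma gact_fwd a s r :
  walk a s -> gact (fwd a s) (walk_end a s, r) = Some (a, s ++ r).
Proof.
elim: s a => [|x s IHs] a /=; first by rewrite gact_vertex asboolT.
by case=> <- ws; rewrite gactM (IHs _ ws) /= gact_edge asboolT.
Qed.

Lemma gact_bwd a s r :
  walk a s -> gact (bwd a s) (a, s ++ r) = Some (walk_end a s, r).
Proof.
elim: s a => [|x s IHs] a /=; first by rewrite gact_vertex asboolT.
by case=> <- ws; rewrite gactM gact_edgeV /= asboolT //= IHs.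
Qed.

Lemma gact_fwd_inv a s p q : walk a s -> gact (fwd a s) p = Some q ->
  exists r, p = (walk_end a s, r) /\ q = (a, s ++ r).
Proof.
elim: s a q => [|x s IHs] a q /=.
  move=> _; rewrite gact_vertex /=; case: asboolP => // pa [<-].
  by exists p.2; rewrite /= -pa; case: p {pa}.
case=> <- ws; rewrite gactM; case fp: (gact _ _) => [p'|//] /=.
have [r [-> ->]] := IHs _ _ ws fp.
by rewrite gact_edge /= asboolT // => -[<-]; exists r.
Qed.

Lemma gact_bwd_inv a s p q : walk a s -> gact (bwd a s) p = Some q ->
  exists r, p = (a, s ++ r) /\ q = (walk_end a s, r).
Proof.
elim: s a p => [|x s IHs] a p /=.
  move=> _; rewrite gact_vertex /=; case: asboolP => // pa [<-].
  by exists p.2; rewrite /= -pa; case: p {pa}.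
case=> <- ws; rewrite gactM gact_edgeV.
case: p => c [|y t] //=; case: asboolP => //= -[-> ->] bt.
by have [r [[->] ->]] := IHs _ _ ws bt; exists r.
Qed.

(** The element [u v^-1]. *)
Definition nf u v : gis E :=
  fwd (psrc u) (pedges u) * bwd (psrc v) (pedges v).

Lemma gact_nf u v r : ptgt u = ptgt v ->
  gact (nf u v) (psrc v, pedges v ++ r) = Some (psrc u, pedges u ++ r).
Proof.
rewrite /ptgt => uv; rewrite gactM gact_bwd /=; last exact: Defs.pathP.
by rewrite -uv gact_fwd //; exact: Defs.pathP.
Qed.

Lemma gact_nf_inv u v p q : gact (nf u v) p = Some q ->
  exists r, p = (psrc v, pedges v ++ r) /\ q = (psrc u, pedges u ++ r).
Proof.
rewrite gactM; case fp: (gact _ _) => [p'|//] /=.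
have [r [-> ->]] := gact_bwd_inv (Defs.pathP v) fp.
by move=> /(gact_fwd_inv (Defs.pathP u))[r' [[_ <-] ->]]; exists r.
Qed.

Lemma nf_neq0 u v : ptgt u = ptgt v -> nf u v <> szero.
Proof. by move=> /(gact_nf [::]) + uv0; rewrite uv0 gact0. Qed.

(** The domain of [nf u v] consists of the extensions of [v], and its image of
   the extensions of [u]; two paths each of which extends the other are
   equal. *)
Lemma nf_inj u v u' v' : ptgt u = ptgt v -> ptgt u' = ptgt v' ->
  nf u v = nf u' v' -> u = u' /\ v = v'.
Proof.
move=> uv uv' eq_nf.
have := gact_nf [::] uv; rewrite eq_nf.
move=> /gact_nf_inv[r [[sv ev] [su eu]]].
have := gact_nf [::] uv'; rewrite -eq_nf.
move=> /gact_nf_inv[r' [[_ ev'] [_ eu']]].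
rewrite !cats0 in ev eu ev' eu'.
by split; apply: path_eq => //; apply: cat_antisym; eassumption.
Qed.

Definition nf_or_zero (g : gis E) : Prop :=
  g = szero \/ exists u v, ptgt u = ptgt v /\ g = nf u v.

(** A letter times a normal form is a normal form or [0]: a vertex or an edge
   acts on [u], and an inverse edge cancels the first edge of [u] or, when [u]
   is trivial, is absorbed at the far end of [v]. *)
Lemma nf_or_zeroP g : nf_or_zero g.
Proof.
have nfP a s b t : walk a s -> walk b t -> walk_end a s = walk_end b t ->
    nf_or_zero (fwd a s * bwd b t).
  by move=> ws wt st; right; exists (Path ws), (Path wt).
have nf_vertex a : nf_or_zero (V a).
  by rewrite -vertexK; apply: (nfP a [::] a [::]).
have nfMl l h : nf_or_zero h -> nf_or_zero (quot_pi _ (letter l) * h).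
  case=> [->|[[a s ws] [[b t wt] [/= st ->]]]].
    by left; rewrite muls0.
  rewrite /nf /= mulgA; case: l => [c|x|x].
  - rewrite -[quot_pi _ _]/(V c); have [<-|ca] := pselect (a = c).
      by rewrite src_fwd //; apply: nfP.
    left; rewrite -(src_fwd ws) mulgA vertex_neq ?mul0s // => ac.
    exact: ca.
  - rewrite -[quot_pi _ _]/(P x); have [ax|ax] := pselect (a = tgt x).
      by subst a; apply: (nfP (src x) (x :: s)) => //; split.
    left; rewrite -edge_tgt -(src_fwd ws) -!mulgA (mulgA (V (tgt x))).
    by rewrite vertex_neq ?mul0s ?muls0 // => /esym.
  - rewrite -[quot_pi _ _]/(N x).
    case: s ws st => [|y s] /= ws st.
      have [ax|ax] := pselect (a = src x); last first.
        left; rewrite -edgeV_src -(mulgA (N x)).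
        by rewrite vertex_neq ?muls0 ?mul0s // => /esym.
      subst a; rewrite edgeV_src.
      have wtx : walk (walk_end b t) [:: x] by split.
      have := bwd_cat wtx; rewrite /= tgt_edgeV => ->; rewrite -tgt_bwd.
      rewrite walk_end_cat /=; apply: (nfP (tgt x) [::]) => //=.
        exact/walk_catE.
      by rewrite walk_end_cat.
    rewrite mulgA; have [xy|xy] := pselect (x = y); last first.
      by left; rewrite edgeV_neq // !mul0s.
    have wsx := proj2 ws.
    by subst y; rewrite edgeVK src_fwd //; apply: nfP.
move: g; apply: presented_ind; first by left.
  case=> [a|x|x]; first exact: nf_vertex.
  - by rewrite -[quot_pi _ _]/(P x) -edge_tgt; apply: (nfMl (gedge x)).
  - by rewrite -[quot_pi _ _]/(N x) -edgeV_src; apply: (nfMl (ginv x)).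
exact: nfMl.
Qed.

(** An [R]-class determines the image of the action and an [L]-class its domain.
   If [g L c R e] and [c = w v^-1], then the image of [c] is that of [e], which
   forces [w = e]; hence [v] ends at [e], and [g = u v^-1] with the same [v]
   since [g] and [c] have the same domain. Conversely [u v^-1 L v^-1 R e]. *)
Lemma D_classP e g :
  D_class e g <-> exists u v, [/\ I_set e u, I_set e v & g = nf u v].
Proof.
split; last first.
  case=> u [v [uE vE ->]]; exists (bwd (psrc v) (pedges v)); split.
    apply/seteqP; split=> _ [->|[h ->]].
    - by right; exists (fwd (psrc u) (pedges u)).
    - by right; exists (h * fwd (psrc u) (pedges u)); rewrite -mulgA.
    - right; exists (bwd (psrc u) (pedges u)).
      rewrite /nf mulgA bwdK; last exact: Defs.pathP.
      by rewrite -/(ptgt u) uE -vE tgt_bwd.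
    - right; exists (h * bwd (psrc u) (pedges u)).
      rewrite /nf -mulgA (mulgA (bwd _ _)) bwdK; last exact: Defs.pathP.
      by rewrite -/(ptgt u) uE -vE tgt_bwd.
  have bE := tgt_bwd (psrc v) (pedges v); rewrite -/(ptgt v) vE in bE.
  have bvE := bwdK (Defs.pathP v); rewrite -/(ptgt v) vE in bvE.
  apply/seteqP; split=> _ [->|[h ->]]; right.
  - by exists (bwd (psrc v) (pedges v)); rewrite bE.
  - by exists (bwd (psrc v) (pedges v) * h); rewrite mulgA bE.
  - by exists (fwd (psrc v) (pedges v)).
  - by exists (fwd (psrc v) (pedges v) * h); rewrite mulgA bvE.
case=> c [gc ce].
have lid (h k : gis E) : green_L h k -> h = k \/ exists z, h = z * k.
  by move=> hk; suff : lideal k h by []; rewrite -hk; left.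
have rid (h k : gis E) : green_R h k -> h = k \/ exists z, h = k * z.
  by move=> hk; suff : rideal k h by []; rewrite -hk; left.
have dom h k p : green_L h k -> gact h p <> None -> gact k p <> None.
  by move=> /lid[->//|[z ->]]; rewrite gactM; case: (gact k p).
have img h k p q : green_R h k -> gact h p = Some q ->
    exists p', gact k p' = Some q.
  move=> /rid[->|[z ->]]; first by exists p.
  by rewrite gactM; case: (gact z p) => // p' kp'; exists p'.
have eact : gact (V e) (e, [::]) = Some (e, [::]).
  by rewrite gact_vertex asboolT.
have [c0|[w [v [wv cE]]]] := nf_or_zeroP c.
  by have [p] := img _ _ _ _ (esym ce) eact; rewrite c0 gact0.
have [we w0] : psrc w = e /\ pedges w = [::].
  have [p] := img _ _ _ _ (esym ce) eact; rewrite cE.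
  move=> /gact_nf_inv[r [_ [-> /esym/nilP]]].
  by rewrite cat_nilp => /andP[/nilP].
have ve : ptgt v = e by rewrite -wv /ptgt /walk_end w0.
have cv : gact c (psrc v, pedges v) <> None.
  by have := gact_nf [::] wv; rewrite cats0 cE => ->.
have [g0|[u [v' [uv' gE]]]] := nf_or_zeroP g.
  by have := dom _ _ _ (esym gc) cv; rewrite g0 gact0.
suff vv' : v = v' by exists u, v'; split=> //; rewrite /I_set /= ?uv' -vv'.
have gv' : gact g (psrc v', pedges v') <> None.
  by have := gact_nf [::] uv'; rewrite cats0 gE => ->.
have := dom _ _ _ gc gv'; have := dom _ _ _ (esym gc) cv.
rewrite cE gE; case gv: (gact _ _) => // _; case cv': (gact _ _) => // _.
have [r [[sv ev] _]] := gact_nf_inv gv.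
have [r' [[_ ev'] _]] := gact_nf_inv cv'.
by apply: path_eq => //; apply: cat_antisym; eassumption.
Qed.

End GraphInverse.

(** * Normal forms in the polycyclic monoid *)

Section PolycyclicNormalForm.
Context (L : Type).

Local Notation one := (quot_pi _ (letter (pol_one L)) : polycyclic L).
Local Notation p i := (quot_pi _ (letter (pol_p i)) : polycyclic L).
Local Notation pV i := (quot_pi _ (letter (pol_inv i)) : polycyclic L).

Fixpoint pol_fwd (s : seq L) : polycyclic L :=
  if s is i :: s' then p i * pol_fwd s' else one.
Fixpoint pol_bwd (s : seq L) : polycyclic L :=
  if s is i :: s' then pol_bwd s' * pV i else one.

Lemma pol_relE w w' :
  pol_rel w w' -> quot_pi (gen_cong (@pol_rel L)) w = quot_pi _ w'.
Proof. by move=> ww'; apply/quot_piP/gen_rel. Qed.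

Lemma pol_mul1l (x : polycyclic L) : one * x = x.
Proof. by rewrite -(quot_reprK x) quot_piM; apply/pol_relE/pol_1l. Qed.

Lemma pol_mul1r (x : polycyclic L) : x * one = x.
Proof. by rewrite -(quot_reprK x) quot_piM; apply/pol_relE/pol_1r. Qed.

Lemma pol_bwd_rcons s i : pol_bwd (rcons s i) = pV i * pol_bwd s.
Proof.
by elim: s => [|j s IHs] /=; rewrite ?pol_mul1l ?pol_mul1r // IHs mulgA.
Qed.

(** The same reduction as for the graph inverse semigroup, with the monoid
   identity in place of the vertices. *)
Lemma polycyclic_nf (x : polycyclic L) :
  x = szero \/ exists s t, x = pol_fwd s * pol_bwd t.
Proof.
move: x; apply: presented_ind; first by left.
  case=> [|i|i]; right.
  - by exists [::], [::]; rewrite /= pol_mul1l.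
  - by exists [:: i], [::]; rewrite /= !pol_mul1r.
  - by exists [::], [:: i]; rewrite /= !pol_mul1l.
move=> l _ [->|[s [t ->]]]; first by left; rewrite muls0.
case: l => [|i|i]; first by right; exists s, t; rewrite pol_mul1l.
  by right; exists (i :: s), t; rewrite mulgA.
case: s => [|j s] /=.
  by right; exists [::], (rcons t i); rewrite pol_bwd_rcons !pol_mul1l.
rewrite mulgA (mulgA (pV i)) quot_piM; have [<-|ij] := pselect (j = i).
  right; exists s, t; congr (_ * _).
  by rewrite (pol_relE (pol_ii j)) pol_mul1l.
by left; rewrite (pol_relE (pol_ij ij)) !mul0s.
Qed.

End PolycyclicNormalForm.

(** * Cutting a path at its visits to a vertex *)

Section LoopFactorization.
Context (E : graph) (e : vertex E) (L : Type) (c : L -> Defs.path E).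
Context (cC : forall i, (C1_set e `\ vpath e) (c i)) (c_inj : injective c).
Context (c_surj : forall u, (C1_set e `\ vpath e) u -> exists i, c i = u).
Implicit Types (u v q : Defs.path E) (s t : seq L).

Lemma psrc_loop i : psrc (c i) = e. Proof. by case: (cC i) => -[[]]. Qed.

Lemma ptgt_loop i : ptgt (c i) = e. Proof. by case: (cC i) => -[[]]. Qed.

Lemma walk_loop i : walk e (pedges (c i)).
Proof. by have := Defs.pathP (c i); rewrite psrc_loop. Qed.

Lemma walk_end_loop i : walk_end e (pedges (c i)) = e.
Proof. by have := ptgt_loop i; rewrite /ptgt psrc_loop. Qed.

Lemma loop_prefix i j : is_prefix (c i) (c j) -> i = j.
Proof.
by move=> ij; apply: c_inj; apply: C1_prefix (cC i) _ ij; case: (cC j).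
Qed.

Fixpoint loops s : seq (edge E) :=
  if s is i :: s' then pedges (c i) ++ loops s' else [::].

Lemma walk_loops s : walk e (loops s).
Proof.
elim: s => //= i s IHs; apply/walk_catE.
by rewrite walk_end_loop; split=> //; exact: walk_loop.
Qed.

Lemma walk_end_loops s : walk_end e (loops s) = e.
Proof. by elim: s => //= i s; rewrite walk_end_cat walk_end_loop. Qed.

(** Unique decipherability of a prefix code whose members are not empty. *)
Lemma loops_inj : injective loops.
Proof.
have nonnil i r : pedges (c i) ++ r <> [::].
  move=> /nilP; rewrite cat_nilp => /andP[/nilP ci _].
  by case: (cC i) => _; apply; apply: path_eq => //; exact: psrc_loop.
elim=> [|i s IHs] [|j t] //=; first by move/esym/nonnil.
  by move/nonnil.
move=> st; suff ij : i = j by subst j; rewrite (IHs t) //; exact: cat_injr st.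
case: (cat_comparable st) => -[r rE]; [|apply: esym];
  by apply: loop_prefix; apply/is_prefixP; rewrite !psrc_loop; split=> //;
     exists r.
Qed.

Lemma walk_append q s : ptgt q = e -> walk (psrc q) (pedges q ++ loops s).
Proof.
move=> qe; apply/walk_catE; rewrite -/(ptgt q) qe; split.
  exact: Defs.pathP.
exact: walk_loops.
Qed.

Definition append q (qe : ptgt q = e) s : Defs.path E :=
  Path (walk_append s qe).

Lemma ptgt_append q (qe : ptgt q = e) s : ptgt (append qe s) = e.
Proof. by rewrite /ptgt walk_end_cat -/(ptgt q) qe walk_end_loops. Qed.

Lemma append_inj q q' (qe : ptgt q = e) (qe' : ptgt q' = e) s t :
    Q_set e q -> Q_set e q' -> append qe s = append qe' t ->
  q = q' /\ s = t.
Proof.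
move=> Qq Qq' [sq eq]; suff qq' : q = q'.
  by split=> //; apply: loops_inj; subst q'; exact: cat_injr eq.
case: (cat_comparable eq) => -[r rE]; [|apply: esym];
  by apply: (@Q_prefix _ e) => //; apply/is_prefixP; split=> //; exists r.
Qed.

Lemma Q_vpath : Q_set e (vpath e).
Proof.
split=> // v /is_prefixP[ve [r /esym/nilP]]; rewrite cat_nilp.
by move=> /andP[/nilP v0 _] []; exact: path_eq.
Qed.

(** Induction on the length, removing the first edge. If [u] starts away from
   [e], that edge goes to the member of [Q_set e]; if [u] starts at [e], the
   edge turns that member into a first-return loop, and the new member of
   [Q_set e] is the trivial path. *)
Lemma factorization u : ptgt u = e ->
  exists q (qe : ptgt q = e) s, Q_set e q /\ u = append qe s.
Proof.
case: u => a es; elim: es a => [|x es IHes] a wu; rewrite /ptgt /= => ue.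
  by exists (vpath e), erefl, [::]; split; [exact: Q_vpath|exact: path_eq].
case: (wu) => xa wes.
have [q [qe [s [Qq [sq esE]]]]] := IHes (tgt x) wes ue.
have wxq : walk a (x :: pedges q).
  by split=> //; rewrite sq; exact: Defs.pathP.
pose xq := Path wxq.
have xqe : ptgt xq = e.
  by rewrite -qe /ptgt /= -sq.
(* The one property behind both cases: a proper prefix of [xq] of positive
   length is [x] followed by a proper prefix of [q]. *)
have xq_prefix v : is_prefix v xq -> v <> xq -> pedges v <> [::] -> ptgt v <> e.
  move=> /is_prefixP[/= va [r]].
  case: v va => b [|y vs] //= wv ab [yx vsE] vxq _; subst b y.
  have wvs := proj2 wv.
  suff : ptgt (Path wvs) <> e by [].
  apply: (proj2 Qq); first by apply/is_prefixP; split; rewrite //=; exists r.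
  by move=> vsq; apply: vxq; apply: path_eq; rewrite //= -vsq.
have [ae|ae] := pselect (a = e).
  subst a; have /c_surj[i ci] : (C1_set e `\ vpath e) xq.
    split; last by move=> /(congr1 (@pedges E)).
    split=> // v vx vxq; rewrite lt0n /plen => v0; apply: xq_prefix => // vn.
    by rewrite vn in v0.
  exists (vpath e), erefl, (i :: s); split; first exact: Q_vpath.
  by apply: path_eq; rewrite //= ci /= esE.
have Qxq : Q_set e xq.
  split=> // v vx vxq; have [v0|v0] := pselect (pedges v = [::]).
    by rewrite /ptgt v0 /walk_end /=; case/is_prefixP: vx => ->.
  exact: xq_prefix.
by exists xq, xqe, s; split=> //; apply: path_eq; rewrite //= esE.
Qed.

End LoopFactorization.

(** * The Brandt extension inside the graph inverse semigroup *)

Lemma bwd_fwd_prefix0 (E : graph) (u v : Defs.path E) :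
    ~ is_prefix u v -> ~ is_prefix v u ->
  bwd (psrc u) (pedges u) * fwd (psrc v) (pedges v) = szero.
Proof.
move=> uv vu; apply: bwd_fwd0; [exact: Defs.pathP|exact: Defs.pathP|].
case=> suv [pre|pre]; first by apply: uv; apply/is_prefixP.
by apply: vu; apply/is_prefixP.
Qed.

Section BrandtToGraphInverse.
Context (E : graph) (e : vertex E) (L : Type) (c : L -> Defs.path E).
Context (cC : forall i, (C1_set e `\ vpath e) (c i)) (c_inj : injective c).
Context (c_surj : forall u, (C1_set e `\ vpath e) u -> exists i, c i = u).
Implicit Types (s t : seq L) (q : Q_set e).

Definition pol_letter_val (l : pol_letter L) : gis E :=
  match l with
  | pol_one => gis_vertex e
  | pol_p i => fwd e (pedges (c i))
  | pol_inv i => bwd e (pedges (c i))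
  end.

Lemma vertex_pol_letter l : gis_vertex e * pol_letter_val l = pol_letter_val l.
Proof.
case: l => [|i|i] /=; first exact: vertexK.
  by rewrite src_fwd //; exact: walk_loop.
by rewrite -{1}(walk_end_loop cC i) tgt_bwd.
Qed.

Lemma pol_letter_vertex l : pol_letter_val l * gis_vertex e = pol_letter_val l.
Proof.
case: l => [|i|i] /=; first exact: vertexK.
  by rewrite -{2}(walk_end_loop cC i) fwd_tgt.
by rewrite bwd_src //; exact: walk_loop.
Qed.

Lemma vertex_pol_word w :
  gis_vertex e * free0_val pol_letter_val w = free0_val pol_letter_val w.
Proof.
case: w => [[l [|k s]]|] /=; rewrite ?muls0 ?vertex_pol_letter //.
by rewrite mulgA vertex_pol_letter.
Qed.

Lemma pol_word_vertex w :
  free0_val pol_letter_val w * gis_vertex e = free0_val pol_letter_val w.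
Proof.
case: w => [[l s]|] /=; rewrite ?mul0s //.
by elim: s l => [|k s IHs] l /=; rewrite ?pol_letter_vertex // -mulgA IHs.
Qed.

(** The loops [c i] satisfy the polycyclic relations because they form a prefix
   code of closed paths at [e]. *)
Lemma pol_letter_val_rel w w' : pol_rel w w' ->
  free0_val pol_letter_val w = free0_val pol_letter_val w'.
Proof.
case=> {w'} [w'|w'|i|i j ij]; rewrite free0_valM /=.
- exact: vertex_pol_word.
- exact: pol_word_vertex.
- by rewrite bwdK ?walk_end_loop //; exact: walk_loop.
- have := @bwd_fwd_prefix0 E (c j) (c i).
  rewrite !(psrc_loop cC); apply.
    by move/(loop_prefix cC c_inj)/esym.
  by move/(loop_prefix cC c_inj).
Qed.

Definition pol_val : polycyclic L -> gis E := presented_val pol_letter_val.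

Lemma pol_valM x y : pol_val (x * y) = pol_val x * pol_val y.
Proof. exact: (presented_valM pol_letter_val_rel). Qed.

Lemma pol_val0 : pol_val szero = szero.
Proof. exact: (presented_val_pi pol_letter_val_rel). Qed.

Lemma pol_val_letter l : pol_val (quot_pi _ (letter l)) = pol_letter_val l.
Proof. exact: (presented_val_pi pol_letter_val_rel). Qed.

Lemma pol_val_vertex x : pol_val x * gis_vertex e = pol_val x.
Proof. exact: pol_word_vertex. Qed.

Lemma pol_val_fwd s : pol_val (pol_fwd s) = fwd e (loops c s).
Proof.
elim: s => [|i s IHs] /=; first by rewrite pol_val_letter.
rewrite pol_valM pol_val_letter IHs /=.
have := @fwd_cat _ e (pedges (c i)) (loops c s).
by rewrite walk_end_loop //; apply; exact: walk_loops.
Qed.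

Lemma pol_val_bwd s : pol_val (pol_bwd s) = bwd e (loops c s).
Proof.
elim: s => [|i s IHs] /=; first by rewrite pol_val_letter.
rewrite pol_valM pol_val_letter IHs /=.
have := @bwd_cat _ e (pedges (c i)) (loops c s).
by rewrite walk_end_loop //; apply; exact: walk_loops.
Qed.

Definition Qfwd q : gis E := fwd (psrc (val q)) (pedges (val q)).
Definition Qbwd q : gis E := bwd (psrc (val q)) (pedges (val q)).

Lemma Q_valP q : Q_set e (val q). Proof. exact: set_valP. Qed.

Lemma Q_tgt_val q : ptgt (val q) = e. Proof. by case: (Q_valP q). Qed.

Lemma QbwdK q : Qbwd q * Qfwd q = gis_vertex e.
Proof.
by rewrite -(Q_tgt_val q) /Qbwd bwdK //; exact: Defs.pathP.
Qed.

Lemma Qbwd_neq q q' : q <> q' -> Qbwd q * Qfwd q' = szero.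
Proof.
move=> qq'; have neq : val q <> val q' by move/val_inj.
apply: bwd_fwd_prefix0 => pre; apply: neq; [|apply: esym];
  exact: Q_prefix (Q_valP _) (Q_valP _) pre.
Qed.

Local Notation brandt_pre := (brandt_val pol_val Qfwd Qbwd).

Lemma brandt_pre_nf q s t q' :
  brandt_pre (Some (q, pol_fwd s * pol_bwd t, q')) =
  nf (append cC (Q_tgt_val q) s) (append cC (Q_tgt_val q') t).
Proof.
rewrite /= pol_valM pol_val_fwd pol_val_bwd mulgA -[LHS]mulgA /nf /=.
have qe r : walk_end (psrc (val r)) (pedges (val r)) = e := Q_tgt_val r.
congr (_ * _).
  have := @fwd_cat _ (psrc (val q)) (pedges (val q)) (loops c s).
  by rewrite qe; apply; exact: walk_loops.
have := @bwd_cat _ (psrc (val q')) (pedges (val q')) (loops c t).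
by rewrite qe; apply; exact: walk_loops.
Qed.

(** By [polycyclic_nf], so that [brandt_pre_nf] applies to every triple outside
   the ideal that is collapsed. *)
Lemma brandt_pre_cases (x : brandt (Q_set e) (polycyclic L)) :
  brandt_zeros x \/ exists q s t q', x = Some (q, pol_fwd s * pol_bwd t, q').
Proof.
case: x => [[[q x] q']|]; last by left; left.
case: (polycyclic_nf x) => [->|[s [t ->]]]; first by left; right; exists q, q'.
by right; exists q, s, t, q'.
Qed.

Lemma brandt_pre_zero x : brandt_zeros x -> brandt_pre x = szero.
Proof. by case=> [->|[a [b ->]]] //=; rewrite pol_val0 muls0 mul0s. Qed.

Definition brandt_gis : brandt0 (Q_set e) (polycyclic L) -> gis E :=
  brandt0_val pol_val Qfwd Qbwd.

Lemma brandt_gisM x y : brandt_gis (x * y) = brandt_gis x * brandt_gis y.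
Proof.
exact: (brandt0_valM pol_val0 pol_valM pol_val_vertex QbwdK Qbwd_neq).
Qed.

(** A normal form determines its two paths, and each of these determines its
   member of [Q_set e] and its word of loops. *)
Lemma brandt_gis_inj : injective brandt_gis.
Proof.
move=> x y; rewrite -(quot_reprK x) -(quot_reprK y).
rewrite /brandt_gis !(brandt0_val_pi _ _ pol_val0) => xy; apply/quot_piP.
case: (brandt_pre_cases (quot_repr x)) xy => [x0|[q [s [t [q' ->]]]]].
  case: (brandt_pre_cases (quot_repr y)) => [y0|[r [s' [t' [r' ->]]]]].
    by right.
  rewrite brandt_pre_nf brandt_pre_zero // => /esym/nf_neq0[].
  by rewrite !ptgt_append.
case: (brandt_pre_cases (quot_repr y)) => [y0|[r [s' [t' [r' ->]]]]].
  rewrite brandt_pre_nf (brandt_pre_zero y0) => /nf_neq0[].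
  by rewrite !ptgt_append.
rewrite !brandt_pre_nf => /nf_inj[]; rewrite ?ptgt_append // => eql eqr.
have [/val_inj-> ->] := append_inj c_inj (Q_valP q) (Q_valP r) eql.
have [/val_inj-> ->] := append_inj c_inj (Q_valP q') (Q_valP r') eqr.
by left.
Qed.

Lemma range_brandt_gis : range brandt_gis = D0_class e.
Proof.
apply/seteqP; split=> [_ [x _ <-]|g].
  rewrite -(quot_reprK x) /brandt_gis (brandt0_val_pi _ _ pol_val0).
  case: (brandt_pre_cases (quot_repr x)) => [x0|[q [s [t [q' ->]]]]].
    by right; rewrite brandt_pre_zero.
  left; apply/D_classP; rewrite brandt_pre_nf.
  by eexists _, _; split; last reflexivity; rewrite /I_set /= ptgt_append.
case=> [/D_classP[u [v [ue ve ->]]]|->]; last first.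
  exists (quot_pi _ (None : brandt _ _)) => //.
  by rewrite /brandt_gis (brandt0_val_pi _ _ pol_val0).
have [q [qe [s [Qq uE]]]] := factorization cC c_surj ue.
have [q' [qe' [t [Qq' vE]]]] := factorization cC c_surj ve.
pose x : brandt (Q_set e) (polycyclic L) :=
  Some (SigSub (mem_set Qq), pol_fwd s * pol_bwd t, SigSub (mem_set Qq')).
exists (quot_pi _ x) => //.
rewrite /brandt_gis (brandt0_val_pi _ _ pol_val0) brandt_pre_nf uE vE.
by congr nf; apply: path_eq.
Qed.

End BrandtToGraphInverse.

Theorem theorem4 (E : graph) (e : vertex E) (L : Type)
    (hL : [set: L] #= C1_set e `\ vpath e) :
  subsemigroup (D0_class e) /\
  subsemigroup_iso (D0_class e) (brandt0 (Q_set e) (polycyclic L)).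
Proof.
have /card_bijP[f [g fK gK]] := hL.
have memT i : i \in [set: L] by rewrite in_setT.
pose c (i : L) : Defs.path E := val (f (SigSub (memT i))).
have cC i : (C1_set e `\ vpath e) (c i) by exact: set_valP.
have c_inj : injective c.
  by move=> i j /val_inj/(can_inj fK)/(congr1 val).
have c_surj u : (C1_set e `\ vpath e) u -> exists i, c i = u.
  move=> Cu; exists (val (g (SigSub (mem_set Cu)))).
  rewrite /c (_ : SigSub _ = g (SigSub (mem_set Cu))) ?gK //.
  exact: val_inj.
rewrite -(range_brandt_gis cC c_inj c_surj).
apply: subsemigroup_iso_range.
- exact: brandt_gisM.
- exact: brandt_gis_inj.
- exact: (quot_pi _ (None : brandt _ _)).
Qed.
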